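(* With the multiplication $m$, comultiplication $\mu$, unit and counit $\varepsilon$ described in the context, $dWHA$ is a connected graded bialgebra over $\mathbf{Z}$: $m$ is associative with unit the empty substitution, $\mu$ is coassociative with counit $\varepsilon$, all structure maps respect the grading, and $\mu$ is an algebra morphism, i.e. $\mu\circ m=(m\otimes m)\circ(\mathrm{id}\otimes \mathrm{tw}\otimes \mathrm{id})\circ(\mu\otimes\mu)$, where $\mathrm{tw}(a\otimes b)=b\otimes a$. Consequently $dWHA$ is a Hopf algebra.
   Context: Words are finite sequences of letters; $*$ denotes concatenation; the support $\mathrm{supp}(\alpha)$ of a word is the set of letters occurring in it. The shuffle product $\alpha\times_{sh}\beta$ of words $\alpha=[c_1,\dots,c_p]$, $\beta=[d_1,\dots,d_q]$ is the sum, with multiplicities, over all ways of choosing $p$ of the $p+q$ positions, of the word obtained by placing the $c$'s in their original order in the chosen positions and the $d$'s in their original order in the remaining ones. A subword of $[a_1,\dots,a_m]$ is a word $[a_{i_1},\dots,a_{i_r}]$ with $i_1<\dots<i_r$. Definition of $dWHA$: Let $\mathcal X$ be a countably infinite alphabet. A substitution is a pair $p=\binom{\rho}{\sigma}$ of words over $\mathcal X$ with $\mathrm{supp}(\rho)=\mathrm{supp}(\sigma)$, considered up to simultaneously renaming the letters of both words by a bijection of $\mathcal X$. $dWHA$ is the free abelian group with basis all substitutions (including the empty substitution $\binom{[\,]}{[\,]}$), graded by $\deg(p)=\#\mathrm{supp}(\rho)$. Multiplication: for substitutions $p=\binom{\rho}{\sigma}$, $p'=\binom{\rho'}{\sigma'}$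 written with $\mathrm{supp}(\rho)\cap\mathrm{supp}(\rho')=\emptyset$, $m(p\otimes p')=\binom{\rho*\rho'}{\sigma\times_{sh}\sigma'}$, meaning the sum of $\binom{\rho*\rho'}{\gamma}$ over the terms $\gamma$ (with multiplicity) of $\sigma\times_{sh}\sigma'$. The unit is the empty substitution. A good cut of a word $\sigma$ is a factorization $\sigma=\sigma_1*\sigma_2$ with $\mathrm{supp}(\sigma_1)\cap\mathrm{supp}(\sigma_2)=\emptyset$ (the two trivial cuts included). Comultiplication: $\mu(p)=\sum \binom{p^{-1}(\sigma_1)}{\sigma_1}\otimes\binom{p^{-1}(\sigma_2)}{\sigma_2}$, summed over all good cuts $\sigma=\sigma_1*\sigma_2$, where $p^{-1}(\sigma_i)$ is the subword of $\rho$ consisting of all occurrences in $\rho$ of letters of $\mathrm{supp}(\sigma_i)$. Counit: $\varepsilon$ is $1$ on the empty substitution and $0$ on all other substitutions. *)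

(* Defs.v *)
(* dWHA is modelled as the free Z-module {malg int[subst]}
   (finitely supported int-valued functions) on the canonical representatives
   of substitutions; tensor powers of dWHA are free Z-modules on tuples of
   basis elements. *)
From HB Require Import structures.
From mathcomp Require Import all_boot all_algebra.
From mathcomp Require Import finmap.
From mathcomp.multinomials Require Import monalg.

Set Implicit Arguments.
Unset Strict Implicit.
Unset Printing Implicit Defensive.

Import GRing.Theory.
Local Open Scope ring_scope.

(* Words over the countably infinite alphabet X = nat.                *)

Definition is_subst_pair (p : seq nat * seq nat) : bool :=
  all (fun x => x \in p.2) p.1 && all (fun x => x \in p.1) p.2.

(* Canonical renaming: letters renamed 0,1,2,... in order of first
   occurrence in sigma.  Two substitutions are equal up to renaming by a
   bijection of X iff their canonical forms coincide. *)
Definition canon (p : seq nat * seq nat) : seq nat * seq nat :=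
  let l := undup p.2 in
  ([seq index x l | x <- p.1], [seq index x l | x <- p.2]).

Definition is_canon_subst (p : seq nat * seq nat) : bool :=
  is_subst_pair p && (canon p == p).

Definition subst := {p : seq nat * seq nat | is_canon_subst p}.

Lemma empty_subst_proof : is_canon_subst ([::], [::]).
Proof. by []. Qed.

Definition empty_subst : subst := exist _ ([::], [::]) empty_subst_proof.

Definition cls (p : seq nat * seq nat) : subst := insubd empty_subst (canon p).

Definition deg (p : subst) : nat := size (undup (val p).2).

(* Shuffle product of words, with multiplicities: one term for each
   choice of (size s) positions among (size s + size t).               *)

Fixpoint masks (n k : nat) : seq bitseq :=
  match n with
  | 0 => if k == 0 then [:: [::]] else [::]
  | n'.+1 =>
      [seq true :: m | m <- (if k is k'.+1 then masks n' k' else [::])]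
      ++ [seq false :: m | m <- masks n' k]
  end.

Fixpoint merge_mask (m : bitseq) (s t : seq nat) : seq nat :=
  match m with
  | [::] => [::]
  | b :: m' =>
      if b then head 0 s :: merge_mask m' (behead s) t
      else head 0 t :: merge_mask m' s (behead t)
  end.

Definition shuffle (s t : seq nat) : seq (seq nat) :=
  [seq merge_mask m s t | m <- masks (size s + size t) (size s)].

Notation FZ K := {malg int[K]}.
Notation D := (FZ subst).

Definition lin {A B : choiceType} (f : A -> FZ B) (x : FZ A) : FZ B :=
  \sum_(k <- msupp x) x@_k *: f k.

Definition tensor {A B : choiceType} (x : FZ A) (y : FZ B) : FZ (A * B)%type :=
  \sum_(a <- msupp x) \sum_(b <- msupp y) (x@_a * y@_b) *: << (a, b) >>.

Definition tens {A B A' B' : choiceType} (f : FZ A -> FZ A') (g : FZ B -> FZ B')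
  : FZ (A * B)%type -> FZ (A' * B')%type :=
  lin (fun k => tensor (f << k.1 >>) (g << k.2 >>)).

Definition idD (x : D) : D := x.

Definition mid_tw {A B C E : choiceType}
  : FZ ((A * B) * (C * E))%type -> FZ ((A * C) * (B * E))%type :=
  lin (fun k => << ((k.1.1, k.2.1), (k.1.2, k.2.2)) >>).

Definition reassoc {A B C : choiceType} : FZ (A * (B * C))%type -> FZ ((A * B) * C)%type :=
  lin (fun k => << ((k.1, k.2.1), k.2.2) >>).

(* product of two basis substitutions: rename p' apart (shift by deg p) *)
Definition mul_basis (p q : subst) : D :=
  let k := deg p in
  let rho' := [seq (x + k)%N | x <- (val q).1] in
  let sigma' := [seq (x + k)%N | x <- (val q).2] in
  \sum_(g <- shuffle (val p).2 sigma') << cls ((val p).1 ++ rho', g) >>.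

Definition m_lin : FZ (subst * subst)%type -> D :=
  lin (fun k => mul_basis k.1 k.2).

Definition mulD (a b : D) : D := m_lin (tensor a b).

Definition unitD : D := << empty_subst >>.

Definition good_cut (s : seq nat) (i : nat) : bool :=
  all (fun x => x \notin drop i s) (take i s).

Definition restr (rho sigma1 : seq nat) : seq nat :=
  [seq x <- rho | x \in sigma1].

Definition comul_basis (p : subst) : FZ (subst * subst)%type :=
  let rho := (val p).1 in
  let sigma := (val p).2 in
  \sum_(i <- iota 0 (size sigma).+1 | good_cut sigma i)
     << (cls (restr rho (take i sigma), take i sigma),
         cls (restr rho (drop i sigma), drop i sigma)) >>.

Definition comul : D -> FZ (subst * subst)%type := lin comul_basis.

Definition counit_basis (p : subst) : int := (p == empty_subst)%:R.

Definition counit (a : D) : int := \sum_(k <- msupp a) a@_k * counit_basis k.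

(* (eps (x) id) and (id (x) eps), composed with Z (x) D ~ D ~ D (x) Z *)
Definition counit_l : FZ (subst * subst)%type -> D :=
  lin (fun k => counit_basis k.1 *: << k.2 >>).
Definition counit_r : FZ (subst * subst)%type -> D :=
  lin (fun k => counit_basis k.2 *: << k.1 >>).

Definition homog (n : nat) (a : D) : Prop :=
  forall p, a@_p != 0 -> deg p = n.
Definition homog2 (n : nat) (x : FZ (subst * subst)%type) : Prop :=
  forall k, x@_k != 0 -> (deg k.1 + deg k.2)%N = n.

(* Main.v *)
Require Import Defs.
From HB Require Import structures.
From mathcomp Require Import all_boot all_algebra.
From mathcomp Require Import finmap.
From mathcomp.multinomials Require Import monalg.
Import GRing.Theory.
Set Implicit Arguments.
Unset Strict Implicit.
Unset Printing Implicit Defensive.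
Local Open Scope ring_scope.

(* All product and coproduct identities are checked on arbitrary
   representatives of substitutions, chosen with disjoint supports: renaming
   invariance shows that the product is then given by plain shuffles, and the
   coproduct by plain cuts.  They reduce to the shuffle/deconcatenation
   bialgebra of words; a cut of a shuffle of two words with disjoint supports is
   good iff it comes from good cuts of both words.
   The antipode is Takeuchi's alternating sum of the convolution powers of
   id - eta eps, which is finite on each substitution because the n-th power
   vanishes in degrees < n. *)

(** * Linear extension of maps given on a basis *)

Section Lin.
Implicit Types A B C : choiceType.

(** Frees [lin] from the exact support: linearity compares [x], [y] and [c *: x + y], whose supports
    differ, on one common finite set. *)
Lemma lin_superset {A B} (f : A -> FZ B) (d : {fset A}) (x : FZ A) :
  fsubset (msupp x) d -> lin f x = \sum_(k <- d) x@_k *: f k.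
Proof.
move=> le; rewrite /lin; apply: big_fset_incl => // k _ /mcoeff_outdom ->.
by rewrite scale0r.
Qed.

Lemma lin_is_linear {A B} (f : A -> FZ B) : linear (lin f).
Proof.
move=> c x y; pose d := (msupp x `|` msupp y)%fset.
have le : fsubset (msupp (c *: x + y)) d.
  by apply: fsubset_trans (msuppD_le _ _) _; apply: fsetSU; apply: msuppZ_le.
rewrite (lin_superset _ le) (lin_superset _ (fsubsetUl (msupp x) (msupp y))).
rewrite (lin_superset _ (fsubsetUr (msupp x) (msupp y))) scaler_sumr -big_split /=.
by apply: eq_bigr => k _; rewrite mcoeffD mcoeffZ scalerDl scalerA.
Qed.

HB.instance Definition _ A B (f : A -> FZ B) :=
  GRing.isLinear.Build int (FZ A) (FZ B) *:%R (lin f) (lin_is_linear f).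

Lemma linU {A B} (f : A -> FZ B) k : lin f << k >> = f k.
Proof. by rewrite (lin_superset _ msuppU_le) big_seq_fset1 mcoeffUU scale1r. Qed.

Lemma eq_lin {A B} (f g : A -> FZ B) : f =1 g -> lin f =1 lin g.
Proof. by move=> fg x; apply: eq_bigr => k _; rewrite fg. Qed.

Lemma linDf {A B} (f g : A -> FZ B) x :
  lin (fun k => f k + g k) x = lin f x + lin g x.
Proof. by rewrite /lin -big_split; apply: eq_bigr => k _; rewrite scalerDr. Qed.

Lemma linZf {A B} c (f : A -> FZ B) x :
  lin (fun k => c *: f k) x = c *: lin f x.
Proof.
by rewrite /lin scaler_sumr; apply: eq_bigr => k _; rewrite !scalerA mulrC.
Qed.

Lemma lin_lin {A B C} (g : B -> FZ C) (f : A -> FZ B) x :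
  lin g (lin f x) = lin (fun k => lin g (f k)) x.
Proof.
by rewrite {2}/lin linear_sum; apply: eq_bigr => k _; rewrite linearZ.
Qed.

Lemma lin_id {A} (x : FZ A) : lin (fun k => << k >>) x = x.
Proof.
rewrite [RHS]monalgE; apply: eq_bigr => k _.
by apply/malgP => l; rewrite mcoeffZ !mcoeffU mulrnAr mulr1.
Qed.

Lemma linC {A B C} (f : A -> B -> FZ C) x y :
  lin (fun a => lin (f a) y) x = lin (fun b => lin (fun a => f a b) x) y.
Proof.
rewrite /lin; under eq_bigr do rewrite scaler_sumr.
rewrite exchange_big /=; apply: eq_bigr => b _; rewrite scaler_sumr.
by apply: eq_bigr => a _; rewrite !scalerA mulrC.
Qed.

Lemma tensorE {A B} (x : FZ A) (y : FZ B) :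
  tensor x y = lin (fun a => lin (fun b => << (a, b) >>) y) x.
Proof.
apply: eq_bigr => a _; rewrite /lin scaler_sumr.
by apply: eq_bigr => b _; rewrite scalerA.
Qed.

Lemma tensorU {A B} (a : A) (b : B) : tensor << a >> << b >> = << (a, b) >>.
Proof. by rewrite tensorE !linU. Qed.

Lemma lin_tensor {A B C} (f : A * B -> FZ C) x y :
  lin f (tensor x y) = lin (fun a => lin (fun b => f (a, b)) y) x.
Proof.
rewrite tensorE lin_lin; apply: eq_lin => a; rewrite lin_lin.
by apply: eq_lin => b; rewrite linU.
Qed.

Lemma lin_sumU {A B I} (f : A -> FZ B) (r : seq I) (P : pred I) (F : I -> A) :
  lin f (\sum_(i <- r | P i) << F i >>) = \sum_(i <- r | P i) f (F i).
Proof. by rewrite linear_sum; apply: eq_bigr => i _; rewrite -[RHS]linU. Qed.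

Lemma lin_sumf {A B I} (F : I -> A -> FZ B) (r : seq I) x :
  lin (fun k => \sum_(i <- r) F i k) x = \sum_(i <- r) lin (F i) x.
Proof.
rewrite /lin; under eq_bigr do rewrite scaler_sumr.
exact: exchange_big.
Qed.

Lemma lin0f {A B} x : lin (fun _ : A => 0 : FZ B) x = 0.
Proof. by rewrite /lin big1 // => k _; rewrite scaler0. Qed.

Lemma tensor_sumU {A B I J} (r : seq I) (s : seq J) (F : I -> A) (G : J -> B) :
  tensor (\sum_(i <- r) << F i >>) (\sum_(j <- s) << G j >>) =
  \sum_(i <- r) \sum_(j <- s) << (F i, G j) >>.
Proof. by rewrite tensorE lin_sumU; apply: eq_bigr => i _; rewrite lin_sumU. Qed.

(** Serves the degree arguments on coproducts, where two maps agree only on basis elements of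
    bounded degree. *)
Lemma eq_lin_in {A B} (f g : A -> FZ B) x :
  (forall k, x@_k != 0 -> f k = g k) -> lin f x = lin g x.
Proof.
by move=> fg; apply: eq_big_seq => k; rewrite -mcoeff_neq0 => /fg ->.
Qed.

Lemma mcoeff_lin {A B} (f : A -> FZ B) x k :
  (lin f x)@_k = \sum_(a <- msupp x) x@_a * (f a)@_k.
Proof. by rewrite raddf_sum; apply: eq_bigr => a _; apply: mcoeffZ. Qed.

Lemma mcoeff_lin_neq0 {A B} (f : A -> FZ B) x k :
  (lin f x)@_k != 0 -> exists2 a, x@_a != 0 & (f a)@_k != 0.
Proof.
move=> nz; case: (boolP (has (fun a => (f a)@_k != 0) (msupp x))) => [/hasP [a]|].
  by rewrite -mcoeff_neq0 => ? ?; exists a.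
move/hasPn => z; case/eqP: nz; rewrite mcoeff_lin big1_seq // => a /= /z.
by rewrite negbK => /eqP ->; rewrite mulr0.
Qed.

(** Locates the basis elements occurring in a product or a coproduct from its defining sum, which is
    how degrees are computed below. *)
Lemma mcoeff_sumU_neq0 {A} {I : eqType} (r : seq I) (P : pred I) (F : I -> A) k :
  (\sum_(i <- r | P i) (<< F i >> : FZ A))@_k != 0 ->
  exists i, [/\ i \in r, P i & F i = k].
Proof.
move=> nz; case: (boolP (has (fun i => P i && (F i == k)) r)) => [/hasP [i ir]|].
  by case/andP => Pi /eqP e; exists i.
move/hasPn => z; case/eqP: nz; rewrite raddf_sum big1_seq // => i /andP [Pi ir].
by move: (z i ir); rewrite Pi /= [LHS]mcoeffU => /negbTE ->.
Qed.

End Lin.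

(** * Shuffles and cuts of words *)

Section Words.
Implicit Types s t u v : seq nat.

Lemma masks_nil n k : (n < k)%N -> masks n k = [::].
Proof.
elim: n k => [|n IH] [|k] //= lt; rewrite !IH //.
by apply: ltn_trans lt; apply: ltnSn.
Qed.

Lemma masks0 n : masks n 0 = [:: nseq n false].
Proof. by elim: n => //= n ->. Qed.

Lemma masksn n : masks n n = [:: nseq n true].
Proof. by elim: n => //= n ->; rewrite masks_nil. Qed.

Lemma shuffle0s t : shuffle [::] t = [:: t].
Proof.
rewrite /shuffle masks0 /= add0n; congr [:: _].
by elim: t => //= x t ->.
Qed.

Lemma shuffles0 s : shuffle s [::] = [:: s].
Proof.
rewrite /shuffle addn0 masksn /=; congr [:: _].
by elim: s => //= x s ->.
Qed.

(** The first letter of a shuffle comes from one word or the other. Together with the two empty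
    cases this recursion replaces the masks in all later arguments. *)
Lemma shuffle_cons x s y t :
  shuffle (x :: s) (y :: t) =
  map (cons x) (shuffle s (y :: t)) ++ map (cons y) (shuffle (x :: s) t).
Proof.
rewrite /shuffle /= map_cat -!map_comp; congr (_ ++ _).
by rewrite addnS -addSn.
Qed.

Lemma shuffle_ind (P : seq nat -> seq nat -> Prop) :
  (forall t, P [::] t) -> (forall s, P s [::]) ->
  (forall x s y t, P s (y :: t) -> P (x :: s) t -> P (x :: s) (y :: t)) ->
  forall s t, P s t.
Proof.
move=> P0s Ps0 PS; elim=> // x s IHs; elim=> // y t IHt.
by apply: PS.
Qed.

Lemma shuffle_map (f : nat -> nat) s t :
  shuffle (map f s) (map f t) = map (map f) (shuffle s t).
Proof.
move: s t; apply: shuffle_ind => [t|s|x s y t /= IH1 IH2].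
- by rewrite !shuffle0s.
- by rewrite !shuffles0.
rewrite !shuffle_cons IH1 IH2 map_cat -!map_comp.
by congr (_ ++ _); apply: eq_map.
Qed.

Lemma shuffle_perm s t g : g \in shuffle s t -> perm_eq g (s ++ t).
Proof.
move: s t g; apply: shuffle_ind => [t|s|x s y t IH1 IH2] g.
- by rewrite shuffle0s inE => /eqP ->.
- by rewrite shuffles0 inE cats0 => /eqP ->.
rewrite shuffle_cons mem_cat => /orP [] /mapP [h hin ->].
  by rewrite /= perm_cons IH1.
by rewrite perm_sym -[y :: t]cat1s perm_catCA perm_cons perm_sym IH2.
Qed.

(** Recording a cut by its two pieces instead of its index allows recursion on the first letter. *)
Definition splits s : seq (seq nat * seq nat) :=
  [seq (take i s, drop i s) | i <- iota 0 (size s).+1].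

Lemma splits0 : splits [::] = [:: ([::], [::])].
Proof. by []. Qed.

Lemma splits_cons x s :
  splits (x :: s) = ([::], x :: s) :: [seq (x :: w.1, w.2) | w <- splits s].
Proof.
rewrite /splits -[iota 0 (size (x :: s)).+1]/(0%N :: iota (1 + 0) (size s).+1).
by rewrite iotaDl /= -!map_comp; congr (_ :: _); apply: eq_map.
Qed.

Lemma splitsP s w : w \in splits s -> s = w.1 ++ w.2.
Proof. by case/mapP => i _ ->; rewrite /= cat_take_drop. Qed.

Lemma splits_map (f : nat -> nat) s :
  splits (map f s) = [seq (map f w.1, map f w.2) | w <- splits s].
Proof.
rewrite /splits size_map -map_comp; apply: eq_map => i /=.
by rewrite map_take map_drop.
Qed.

End Words.

(** * The shuffle/deconcatenation bialgebra of words, tested against an arbitrary function *)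

Section WordSums.
Variable V : zmodType.
Implicit Types s t u v : seq nat.

Lemma big_shuffle_cons (F : seq nat -> V) x s y t :
  \sum_(g <- shuffle (x :: s) (y :: t)) F g =
  \sum_(g <- shuffle s (y :: t)) F (x :: g) +
  \sum_(g <- shuffle (x :: s) t) F (y :: g).
Proof. by rewrite shuffle_cons big_cat !big_map. Qed.

Lemma big_shuffle0s (F : seq nat -> V) t : \sum_(g <- shuffle [::] t) F g = F t.
Proof. by rewrite shuffle0s big_seq1. Qed.

Lemma big_shuffles0 (F : seq nat -> V) s : \sum_(g <- shuffle s [::]) F g = F s.
Proof. by rewrite shuffles0 big_seq1. Qed.

Lemma big_splits_cons (F : seq nat * seq nat -> V) x s :
  \sum_(w <- splits (x :: s)) F w =
  F ([::], x :: s) + \sum_(w <- splits s) F (x :: w.1, w.2).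
Proof. by rewrite splits_cons big_cons big_map. Qed.

(** Induction on the three words, according to which of them supplies the first letter. [F] is kept
    general so that this letter can be absorbed into it. *)
Lemma shuffleA (F : seq nat -> V) a b c :
  \sum_(g <- shuffle a b) \sum_(h <- shuffle g c) F h =
  \sum_(g <- shuffle b c) \sum_(h <- shuffle a g) F h.
Proof.
elim: a b c F => [|x a IHa] b c F.
  by rewrite big_shuffle0s; apply: eq_bigr => g _; rewrite big_shuffle0s.
elim: b c F => [|y b IHb] c F; first by rewrite big_shuffles0 big_shuffle0s.
elim: c F => [|z c IHc] F.
  by rewrite big_shuffles0; apply: eq_bigr => g _; rewrite big_shuffles0.
rewrite !big_shuffle_cons.
under eq_bigr do rewrite big_shuffle_cons.
under [X in _ + X]eq_bigr do rewrite big_shuffle_cons.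
under [in RHS]eq_bigr do rewrite big_shuffle_cons.
under [X in _ = _ + X]eq_bigr do rewrite big_shuffle_cons.
(* Terms starting with [x] or [y] are rebracketed by [IHa] and [IHb], those starting with [z] by
   [IHc] read backwards; unfolding the recombined sums leaves only a rearrangement. *)
rewrite !big_split /= (IHa (y :: b) (z :: c) (fun h => F (x :: h))).
rewrite (IHb (z :: c) (fun h => F (y :: h))) -(IHc (fun h => F (z :: h))).
rewrite !big_shuffle_cons /=.
by rewrite [LHS](AC (3*2) ((1*4)*(2*(3*5)))).
Qed.

(** Both sides enumerate the factorizations of [s] into three words. *)
Lemma splitsA (F : seq nat -> seq nat -> seq nat -> V) s :
  \sum_(w <- splits s) \sum_(z <- splits w.1) F z.1 z.2 w.2 =
  \sum_(w <- splits s) \sum_(z <- splits w.2) F w.1 z.1 z.2.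
Proof.
elim: s F => [|x s IH] F; first by rewrite splits0 !big_seq1.
rewrite !big_splits_cons splits0 big_seq1 /=.
under eq_bigr do rewrite big_splits_cons /=.
by rewrite big_split /= (IH (fun u v z => F (x :: u) v z)) addrA.
Qed.

(** Compatibility of product and coproduct for words, over all cuts, good or not. A cut of a shuffle
    has either an empty left piece or a left piece starting with the first letter of [s] or of
    [t]. *)
Lemma splits_shuffle (F : seq nat -> seq nat -> V) s t :
  \sum_(g <- shuffle s t) \sum_(w <- splits g) F w.1 w.2 =
  \sum_(w <- splits s) \sum_(z <- splits t)
    \sum_(u <- shuffle w.1 z.1) \sum_(v <- shuffle w.2 z.2) F u v.
Proof.
move: s t F; apply: shuffle_ind => [t|s|x s y t IH1 IH2] F.
- rewrite big_shuffle0s splits0 big_seq1; apply: eq_bigr => z _.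
  by rewrite !big_shuffle0s.
- rewrite big_shuffles0 splits0; apply: eq_bigr => z _.
  by rewrite big_seq1 !big_shuffles0.
rewrite big_shuffle_cons.
under eq_bigr do rewrite big_splits_cons /=.
under [X in _ + X]eq_bigr do rewrite big_splits_cons /=.
rewrite !big_split /= (IH1 (fun u v => F (x :: u) v)) (IH2 (fun u v => F (y :: u) v)).
(* The right side splits into four families, according to whether the left piece of each word is
   empty. When both are nonempty, their shuffle is split again by its first letter. *)
rewrite !big_splits_cons /=.
under [X in _ + X + _ = _]eq_bigr do rewrite big_splits_cons /= big_shuffles0.
under [X in _ = _ + X]eq_bigr => w _.
  rewrite big_splits_cons /= big_shuffles0.
  under [X in _ + X]eq_bigr do rewrite big_shuffle_cons.
  rewrite big_split /=; over.
rewrite !big_split /= big_shuffle0s big_shuffle_cons.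
under [X in _ + (_ + (X + _)) = _]eq_bigr do rewrite big_shuffle0s.
under [X in _ = _ + X + _]eq_bigr do rewrite big_shuffle0s.
by rewrite [LHS](AC ((1*2)*(1*2)) ((1*4*5)*(2*(3*6)))).
Qed.

End WordSums.

(** * Renaming invariance; product and coproduct on arbitrary representatives *)

Section Renaming.
Implicit Types (f : nat -> nat) (s t u v : seq nat) (P Q : seq nat * seq nat).
Implicit Types p q : subst.

(** Injectivity is asked on a given word only: the renaming used by [canon] is an [index], which
    takes one common value on all letters outside the support. *)
Lemma mem_map_in f s x : {in s &, injective f} ->
  forall t, {subset t <= s} -> x \in s -> (f x \in map f t) = (x \in t).
Proof.
move=> fI t ts xs; apply/mapP/idP => [[y yt /fI ->] //|xt]; last by exists x.
exact: ts.
Qed.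

Lemma undup_map_in f s :
  {in s &, injective f} -> undup (map f s) = map f (undup s).
Proof.
elim: s => //= x s IH fI.
have fIs : {in s &, injective f}.
  by move=> y z ys zs; apply: fI; rewrite inE ?ys ?zs orbT.
rewrite (mem_map_in fI) ?inE ?eqxx //; last first.
  by move=> y ys; rewrite inE ys orbT.
by rewrite IH //; case: (x \in s).
Qed.

Lemma index_map_in f s x : {in s &, injective f} -> x \in s ->
  index (f x) (undup (map f s)) = index x (undup s).
Proof.
move=> fI xs; rewrite undup_map_in //.
have: {subset undup s <= s} by move=> y; rewrite mem_undup.
elim: (undup s) => //= y t IH ts.
rewrite IH; last by move=> z zt; apply: ts; rewrite inE zt orbT.
by rewrite (inj_in_eq fI) // ts // inE eqxx.
Qed.

Definition rename f P := (map f P.1, map f P.2).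

Lemma subst_sub P : is_subst_pair P -> {subset P.1 <= P.2}.
Proof. by case/andP => /allP. Qed.

Lemma is_subst_pairP P : is_subst_pair P <-> P.1 =i P.2.
Proof.
split=> [/andP [/allP s1 /allP s2] x|e].
  by apply/idP/idP => [/s1|/s2].
by apply/andP; split; apply/allP => x; rewrite e.
Qed.

Lemma rename_subst f P : is_subst_pair P -> is_subst_pair (rename f P).
Proof. by move/is_subst_pairP => e; apply/is_subst_pairP/eq_mem_map. Qed.

Lemma canonE P : canon P = rename (index^~ (undup P.2)) P.
Proof. by []. Qed.

Lemma index_undup_inj s : {in s &, injective (index^~ (undup s))}.
Proof. by move=> x y xs ys; apply: (index_inj 0%N); rewrite mem_undup. Qed.

(** [canon] sees a letter only through its position in [undup P.2], and a renaming injective on the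
    support preserves these positions. *)
Lemma canon_rename f P :
  is_subst_pair P -> {in P.2 &, injective f} -> canon (rename f P) = canon P.
Proof.
move=> /subst_sub sP fI; rewrite /canon /= -!map_comp.
by congr (_, _); apply/eq_in_map => x xP /=; rewrite index_map_in // sP.
Qed.

Lemma cls_rename f P :
  is_subst_pair P -> {in P.2 &, injective f} -> cls (rename f P) = cls P.
Proof. by move=> sP fI; rewrite /cls canon_rename. Qed.

(** Since [canon] is itself a renaming injective on the support, it is idempotent on substitutions;
    hence [insubd] never falls back on its default here. *)
Lemma val_cls P : is_subst_pair P -> val (cls P) = canon P.
Proof.
move=> sP; rewrite /cls insubdK //; apply/andP; split.
  exact: rename_subst.
by rewrite [X in canon X]canonE canon_rename //; apply: index_undup_inj.
Qed.

Lemma subst_val p : is_subst_pair (val p).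
Proof. by case: p => P /= /andP []. Qed.

Lemma canon_val p : canon (val p) = val p.
Proof. by case: p => P /= /andP [_ /eqP]. Qed.

Lemma clsK p : cls (val p) = p.
Proof. by apply: val_inj; rewrite val_cls ?subst_val // canon_val. Qed.

Lemma deg_cls P : is_subst_pair P -> deg (cls P) = size (undup P.2).
Proof.
move=> sP; rewrite /deg val_cls // undup_map_in ?size_map //.
exact: index_undup_inj.
Qed.

Lemma cls_eq_empty P : is_subst_pair P -> (cls P == empty_subst) = (P.2 == [::]).
Proof.
move=> sP; rewrite -val_eqE val_cls //= /canon xpair_eqE -!size_eq0 !size_map.
rewrite andb_idl // => /nilP P20; move/is_subst_pairP: sP; rewrite P20.
by case: (P.1) => // x s /(_ x); rewrite inE eqxx.
Qed.

Definition disj s t := all (fun x => x \notin t) s.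

Lemma disjP s t : reflect (forall x, x \in s -> x \in t -> False) (disj s t).
Proof.
apply: (iffP allP) => H x xs; first by move=> xt; move: (H x xs); rewrite xt.
by apply/negP; apply: H.
Qed.

Lemma disjC s t : disj s t = disj t s.
Proof. by apply/disjP/disjP => H x xs xt; apply: (H x). Qed.

Lemma disj_mem s s' t t' : s =i s' -> t =i t' -> disj s t = disj s' t'.
Proof.
move=> es et; rewrite /disj (eq_all_r es); apply: eq_all => x.
by rewrite et.
Qed.

Lemma disj_catl s s' t : disj (s ++ s') t = disj s t && disj s' t.
Proof. exact: all_cat. Qed.

Lemma disj_catr s t t' : disj s (t ++ t') = disj s t && disj s t'.
Proof. by rewrite disjC disj_catl !(disjC s). Qed.

Lemma disj_sub s t s' t' :
  {subset s' <= s} -> {subset t' <= t} -> disj s t -> disj s' t'.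
Proof.
by move=> ss tt /disjP H; apply/disjP => x xs xt; apply: (H x); [apply: ss|apply: tt].
Qed.

(** The canonical form of [P] and the shifted canonical form of [Q] are images of [P] and [Q] under
    one renaming [h], injective on the union of the supports, and shuffling commutes with
    renaming. *)
Lemma mul_basis_cls P Q :
  is_subst_pair P -> is_subst_pair Q -> disj P.2 Q.2 ->
  mul_basis (cls P) (cls Q) =
  \sum_(g <- shuffle P.2 Q.2) << cls (P.1 ++ Q.1, g) >>.
Proof.
move=> sP sQ /disjP dPQ; rewrite /mul_basis (deg_cls sP).
rewrite (val_cls sP) (val_cls sQ) /canon /=.
set k := size _.
pose h x := if x \in P.2 then index x (undup P.2) else (index x (undup Q.2) + k)%N.
have hP s : {subset s <= P.2} -> map (index^~ (undup P.2)) s = map h s.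
  by move=> sub; apply/eq_in_map => x /sub xP; rewrite /h xP.
have hQ s : {subset s <= Q.2} ->
    map (addn^~ k) (map (index^~ (undup Q.2)) s) = map h s.
  move=> sub; rewrite -map_comp; apply/eq_in_map => x /sub xQ; rewrite /h.
  by case: ifP => // xP; case: (dPQ x).
(* [h] takes values below [k] on [P.2] and at least [k] on [Q.2], so only collisions inside one
   support remain. *)
have hI : {in P.2 ++ Q.2 &, injective h}.
  have lt x y : x \in P.2 -> index x (undup P.2) <> (index y (undup Q.2) + k)%N.
    move=> xP e; have: (index x (undup P.2) < k)%N by rewrite index_mem mem_undup.
    by rewrite e ltnNge leq_addl.
  move=> x y; rewrite !mem_cat /h.
  case: ifP => /= [xP _|_ xQ]; case: ifP => /= [yP _|_ yQ].
  - exact: index_undup_inj.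
  - by move/lt => /(_ xP).
  - by move/esym/lt => /(_ yP).
  - by move/addIn; apply: index_undup_inj.
have id s : {subset s <= s} by [].
rewrite (hP _ (subst_sub sP)) (hP _ (id _)) (hQ _ (subst_sub sQ)) (hQ _ (id _)).
rewrite shuffle_map.
rewrite big_map.
apply: eq_big_seq => g gPQ.
have eg := perm_mem (shuffle_perm gPQ).
rewrite -map_cat -[X in cls X]/(rename h (P.1 ++ Q.1, g)) cls_rename //=.
  apply/is_subst_pairP => x /=; rewrite eg !mem_cat.
  by move/is_subst_pairP: sP => ->; move/is_subst_pairP: sQ => ->.
by move=> x y; rewrite !eg; apply: hI.
Qed.

(** The representative of the tensor factor attached to a piece [u] of a cut. *)
Definition part rho u : seq nat * seq nat := (restr rho u, u).

Lemma part_subst rho u : {subset u <= rho} -> is_subst_pair (part rho u).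
Proof.
move=> sub; apply/is_subst_pairP => x /=; rewrite mem_filter.
by apply: andb_idr; apply: sub.
Qed.

Lemma part_id P : is_subst_pair P -> part P.1 P.2 = P.
Proof.
move=> sP; case: P sP => rho s sP; rewrite /part /restr /=; congr (_, _).
by apply/all_filterP/allP; apply: (subst_sub sP).
Qed.

Lemma restr_restr rho u a : {subset a <= u} -> restr (restr rho u) a = restr rho a.
Proof.
move=> sub; rewrite /restr -filter_predI; apply: eq_filter => x /=.
by apply: andb_idr; apply: sub.
Qed.

Lemma part_rename f rho u : {in rho &, injective f} -> {subset u <= rho} ->
  part (map f rho) (map f u) = rename f (part rho u).
Proof.
move=> fI sub; rewrite /part /rename /restr filter_map; congr (map f _, _).
by apply: eq_in_filter => x xr /=; rewrite (mem_map_in fI).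
Qed.

Lemma comul_basisE p :
  comul_basis p =
  \sum_(w <- splits (val p).2 | disj w.1 w.2)
    << (cls (part (val p).1 w.1), cls (part (val p).1 w.2)) >>.
Proof. by rewrite /splits big_map. Qed.

(** Cuts of [P.2] correspond to cuts of its canonical form. The renaming is injective on the
    support, so it preserves both goodness of a cut and restriction to a piece. *)
Lemma comul_basis_cls P : is_subst_pair P ->
  comul_basis (cls P) =
  \sum_(w <- splits P.2 | disj w.1 w.2)
    << (cls (part P.1 w.1), cls (part P.1 w.2)) >>.
Proof.
move=> sP; rewrite comul_basisE (val_cls sP) canonE.
have := index_undup_inj (s := P.2); set f := index^~ _ => fI.
rewrite splits_map big_map [LHS]big_seq_cond [RHS]big_seq_cond.
have eP := (is_subst_pairP P).1 sP.
have fI1 : {in P.1 &, injective f} by move=> x y; rewrite !eP; apply: fI.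
have sub w : w \in splits P.2 -> {subset w.1 <= P.1} /\ {subset w.2 <= P.1}.
  by move/splitsP => e; split=> x xw; rewrite eP e mem_cat xw ?orbT.
apply: eq_big => w.
  case: (boolP (w \in _)) => //= /sub [s1 s2].
  apply/disjP/disjP => H x x1 x2.
    by apply: (H (f x)); rewrite (mem_map_in fI1) ?s1 ?s2.
  case/mapP: x1 x2 => y y1 ->; rewrite (mem_map_in fI1) ?s1 //.
  exact: H.
case/andP => /sub [s1 s2] _ /=; rewrite (part_rename fI1 s1) (part_rename fI1 s2).
have fIw u : {subset u <= P.1} -> {in u &, injective f}.
  by move=> su x y xu yu; apply: fI1; apply: su.
by rewrite !cls_rename; try exact: part_subst; try exact: fIw.
Qed.

End Renaming.

(** * The algebra structure and coassociativity *)

Section Structure.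
Implicit Types (p q r : subst) (a b c : D).

Lemma mulDE a b : mulD a b = lin (fun p => lin (mul_basis p) b) a.
Proof. exact: lin_tensor. Qed.

(** Supplies the disjoint representatives on which products are plain shuffles. *)
Lemma disj_rep p (s : seq nat) :
  exists P, [/\ is_subst_pair P, cls P = p & disj s P.2].
Proof.
(* Shifting by [k] moves every letter beyond all letters of [s]. *)
pose k := (\max_(x <- s) x).+1.
exists (rename (addn k) (val p)); split.
- exact/rename_subst/subst_val.
- rewrite cls_rename ?clsK ?subst_val // => x y _ _; exact: addnI.
apply/disjP => x xs /mapP [y _ e]; have := leq_bigmax_seq (F := id) x xs isT.
by rewrite e leqNgt ltnS leq_addr.
Qed.

Lemma shuffle_subst P Q g : is_subst_pair P -> is_subst_pair Q ->
  g \in shuffle P.2 Q.2 -> is_subst_pair (P.1 ++ Q.1, g).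
Proof.
move=> /is_subst_pairP eP /is_subst_pairP eQ gPQ; apply/is_subst_pairP => x /=.
by rewrite (perm_mem (shuffle_perm gPQ)) !mem_cat eP eQ.
Qed.

(** With three pairwise disjoint representatives no letter is renamed in either bracketing, so
    associativity of concatenation and of shuffles suffices. *)
Lemma mul_basisA p q r :
  lin (mul_basis^~ r) (mul_basis p q) = lin (mul_basis p) (mul_basis q r).
Proof.
have [P [sP <- _]] := disj_rep p [::].
have [Q [sQ <- dPQ]] := disj_rep q P.2.
have [R [sR <-]] := disj_rep r (P.2 ++ Q.2).
rewrite disj_catl => /andP [dPR dQR].
rewrite (mul_basis_cls sP sQ dPQ) (mul_basis_cls sQ sR dQR).
rewrite [LHS]lin_sumU.
rewrite [RHS]lin_sumU.
transitivity (\sum_(g <- shuffle P.2 Q.2) \sum_(h <- shuffle g R.2)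
  << cls ((P.1 ++ Q.1) ++ R.1, h) >> : D).
  apply: eq_big_seq => g gPQ; rewrite mul_basis_cls ?(shuffle_subst sP sQ) //=.
  rewrite (disj_mem (perm_mem (shuffle_perm gPQ)) (fun=> erefl)).
  by rewrite disj_catl dPR.
rewrite shuffleA; apply: eq_big_seq => g gQR.
rewrite (mul_basis_cls sP (shuffle_subst sQ sR gQR)); first by rewrite catA.
rewrite (disj_mem (fun=> erefl) (perm_mem (shuffle_perm gQR))).
by rewrite disj_catr dPQ.
Qed.

Lemma mul_empty_basis p : mul_basis empty_subst p = << p >>.
Proof.
rewrite -[in LHS](clsK p) -(clsK empty_subst).
rewrite (mul_basis_cls (subst_val _) (subst_val p)) // big_shuffle0s.
have -> : ((val empty_subst).1 ++ (val p).1, (val p).2) = val p.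
  by case: (val p).
by rewrite clsK.
Qed.

Lemma mul_basis_empty p : mul_basis p empty_subst = << p >>.
Proof.
rewrite -[in LHS](clsK p) -(clsK empty_subst).
rewrite (mul_basis_cls (subst_val p) (subst_val _)); last by rewrite disjC.
rewrite big_shuffles0.
have -> : ((val p).1 ++ (val empty_subst).1, (val p).2) = val p.
  by rewrite cats0; case: (val p).
by rewrite clsK.
Qed.

Lemma mul1D a : mulD unitD a = a.
Proof.
rewrite mulDE linU -[RHS]lin_id; apply: eq_lin => p.
exact: mul_empty_basis.
Qed.

Lemma mulD1 a : mulD a unitD = a.
Proof.
rewrite mulDE -[RHS]lin_id; apply: eq_lin => p; rewrite linU.
exact: mul_basis_empty.
Qed.

Lemma mulD_linl (A : choiceType) (f : A -> D) x b :
  mulD (lin f x) b = lin (fun k => mulD (f k) b) x.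
Proof. by rewrite [LHS]mulDE [LHS]lin_lin; apply: eq_lin => k; rewrite [RHS]mulDE. Qed.

Lemma mulD_linr (A : choiceType) (f : A -> D) x a :
  mulD a (lin f x) = lin (fun k => mulD a (f k)) x.
Proof.
transitivity (lin (fun p => lin (fun k => lin (mul_basis p) (f k)) x) a).
  by rewrite [LHS]mulDE; apply: eq_lin => p; rewrite [LHS]lin_lin.
by rewrite [LHS]linC; apply: eq_lin => k; rewrite [RHS]mulDE.
Qed.

Lemma mulD_suml I (r : seq I) (c : I -> int) (F : I -> D) b :
  mulD (\sum_(i <- r) c i *: F i) b = \sum_(i <- r) c i *: mulD (F i) b.
Proof.
rewrite mulDE linear_sum; apply: eq_bigr => i _.
by rewrite linearZ [in RHS]mulDE.
Qed.

Lemma mulD_sumr I (r : seq I) (c : I -> int) (F : I -> D) a :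
  mulD a (\sum_(i <- r) c i *: F i) = \sum_(i <- r) c i *: mulD a (F i).
Proof.
transitivity (lin (fun p => \sum_(i <- r) c i *: lin (mul_basis p) (F i)) a).
  rewrite mulDE; apply: eq_lin => p; rewrite linear_sum; apply: eq_bigr => i _.
  exact: linearZ.
rewrite [LHS]lin_sumf; apply: eq_bigr => i _.
by rewrite [LHS]linZf [in RHS]mulDE.
Qed.

Lemma mulDZl x a b : mulD (x *: a) b = x *: mulD a b.
Proof. by rewrite [LHS]mulDE linearZ [in RHS]mulDE. Qed.

Lemma mulDZr x a b : mulD a (x *: b) = x *: mulD a b.
Proof.
rewrite [LHS]mulDE [in RHS]mulDE -linZf; apply: eq_lin => p.
exact: linearZ.
Qed.

Lemma mulDDl a a' b : mulD (a + a') b = mulD a b + mulD a' b.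
Proof. by rewrite [LHS]mulDE linearD [X in _ = X + _]mulDE [X in _ = _ + X]mulDE. Qed.

Lemma mulDDr a b b' : mulD a (b + b') = mulD a b + mulD a b'.
Proof.
rewrite [LHS]mulDE [X in _ = X + _]mulDE [X in _ = _ + X]mulDE -[RHS]linDf.
apply: eq_lin => p; exact: linearD.
Qed.

Lemma mul0D a : mulD 0 a = 0.
Proof. by rewrite [LHS]mulDE linear0. Qed.

Lemma mulD0 a : mulD a 0 = 0.
Proof. by rewrite -(scale0r (0 : D)) [LHS]mulDZr !scale0r. Qed.

Lemma mulDA a b c : mulD (mulD a b) c = mulD a (mulD b c).
Proof.
rewrite [mulD a b]mulDE [LHS]mulD_linl [RHS]mulDE; apply: eq_lin => p.
rewrite [LHS]mulD_linl [mulD b c]mulDE [RHS]lin_lin; apply: eq_lin => q.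
rewrite [LHS]mulDE [RHS]lin_lin [LHS]linC; apply: eq_lin => r.
exact: mul_basisA.
Qed.

Lemma part_part rho u v : {subset v <= u} -> part (restr rho u) v = part rho v.
Proof. by move=> vu; rewrite /part restr_restr. Qed.

(** Iterated cuts can all restrict the original [rho], since restricting to [u] and then to a piece
    of [u] is restricting to that piece. *)
Lemma comul_basis_part rho u : {subset u <= rho} ->
  comul_basis (cls (part rho u)) =
  \sum_(w <- splits u | disj w.1 w.2) << (cls (part rho w.1), cls (part rho w.2)) >>.
Proof.
move=> su; rewrite comul_basis_cls; last exact: part_subst.
rewrite [LHS]big_seq_cond [RHS]big_seq_cond; apply: eq_bigr => w.
case/andP => /splitsP /= e _.
by rewrite !part_part // => x xw; rewrite e mem_cat xw ?orbT.
Qed.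

Lemma comul_basisA p :
  lin (fun k => lin (fun l => << (l, k.2) >>) (comul_basis k.1)) (comul_basis p) =
  lin (fun k => lin (fun l => << ((k.1, l.1), l.2) >>) (comul_basis k.2))
    (comul_basis p).
Proof.
have [P [sP <- _]] := disj_rep p [::]; have /is_subst_pairP eP := sP.
rewrite (comul_basis_cls sP) [LHS]lin_sumU [RHS]lin_sumU.
(* [splitsA] ranges over all cuts, so goodness is moved into the summand as a zero value. In both
   orders of cutting, two good cuts amount to three pairwise disjoint pieces. *)
pose F u v w : FZ _ := if [&& disj u v, disj u w & disj v w]
  then << ((cls (part P.1 u), cls (part P.1 v)), cls (part P.1 w)) >> else 0.
transitivity (\sum_(w <- splits P.2) \sum_(z <- splits w.1) F z.1 z.2 w.2).
  rewrite big_mkcond; apply: eq_big_seq => w /splitsP /= e.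
  have sw : {subset w.1 <= P.1} by move=> x xw; rewrite eP e mem_cat xw.
  rewrite (comul_basis_part sw) lin_sumU [in LHS]big_mkcond.
  case: ifP => d.
    apply: eq_big_seq => z /splitsP ez; rewrite /F.
    by move: d; rewrite ez disj_catl => ->; rewrite andbT.
  rewrite big1_seq // => z /= /splitsP ez; rewrite /F.
  by move: d; rewrite ez disj_catl => ->; rewrite andbF.
rewrite splitsA; apply/esym.
rewrite big_mkcond; apply: eq_big_seq => w /splitsP /= e.
have sw : {subset w.2 <= P.1} by move=> x xw; rewrite eP e mem_cat xw orbT.
rewrite (comul_basis_part sw) lin_sumU [in LHS]big_mkcond.
case: ifP => d.
  apply: eq_big_seq => z /splitsP ez; rewrite /F.
  by move: d; rewrite ez disj_catr andbA => ->.
rewrite big1_seq // => z /= /splitsP ez; rewrite /F.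
by move: d; rewrite ez disj_catr andbA => ->.
Qed.

End Structure.

(** * Multiplicativity of the coproduct, the counit and the grading *)

Section Bialgebra.
Implicit Types (p q r : subst) (a b c : D).

(** Disjointness of the supports keeps letters of [P] out of [v] and letters of [Q] out of [u]. *)
Lemma restr_shuffle P Q u v g :
  is_subst_pair P -> is_subst_pair Q -> disj P.2 Q.2 ->
  {subset u <= P.2} -> {subset v <= Q.2} -> g \in shuffle u v ->
  restr (P.1 ++ Q.1) g = restr P.1 u ++ restr Q.1 v.
Proof.
move=> /is_subst_pairP eP /is_subst_pairP eQ /disjP d su sv guv.
rewrite /restr filter_cat; congr (_ ++ _); apply: eq_in_filter => x.
  rewrite eP (perm_mem (shuffle_perm guv)) mem_cat => xP.
  by case: (boolP (x \in v)); rewrite ?orbF // => /sv /(d x xP).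
rewrite eQ (perm_mem (shuffle_perm guv)) mem_cat => xQ.
by case: (boolP (x \in u)) => //= /su xP; case: (d x xP xQ).
Qed.

Lemma comul_mul_basis p q :
  lin comul_basis (mul_basis p q) =
  lin (fun w => lin (fun z => tensor (mul_basis w.1 z.1) (mul_basis w.2 z.2))
    (comul_basis q)) (comul_basis p).
Proof.
have [P [sP <- _]] := disj_rep p [::].
have [Q [sQ <- dPQ]] := disj_rep q P.2.
have /is_subst_pairP eP := sP; have /is_subst_pairP eQ := sQ.
rewrite (mul_basis_cls sP sQ dPQ) (comul_basis_cls sP) (comul_basis_cls sQ).
rewrite [LHS]lin_sumU [RHS]lin_sumU.
(* Bad cuts are given value zero so that [splits_shuffle] applies to the unrestricted sum. *)
pose F u v : FZ (subst * subst)%type := if disj u v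
  then << (cls (part (P.1 ++ Q.1) u), cls (part (P.1 ++ Q.1) v)) >> else 0.
transitivity (\sum_(g <- shuffle P.2 Q.2) \sum_(w <- splits g) F w.1 w.2).
  apply: eq_big_seq => g gPQ.
  by rewrite (comul_basis_cls (shuffle_subst sP sQ gPQ)) [LHS]big_mkcond.
rewrite splits_shuffle [RHS]big_mkcond; apply: eq_big_seq => w /splitsP ew.
rewrite [in RHS]lin_sumU [X in if _ then X else _]big_mkcond.
transitivity (\sum_(z <- splits Q.2) if disj w.1 w.2 && disj z.1 z.2 then
    tensor (mul_basis (cls (part P.1 w.1)) (cls (part Q.1 z.1)))
           (mul_basis (cls (part P.1 w.2)) (cls (part Q.1 z.2))) else 0);
  last first.
  by case: (disj w.1 w.2) => //=; rewrite big1_eq.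
apply: eq_big_seq => z /splitsP ez.
have [sw1 sw2] : {subset w.1 <= P.2} /\ {subset w.2 <= P.2}.
  by rewrite ew; split=> x xw; rewrite mem_cat xw ?orbT.
have [sz1 sz2] : {subset z.1 <= Q.2} /\ {subset z.2 <= Q.2}.
  by rewrite ez; split=> x xw; rewrite mem_cat xw ?orbT.
(* The cross conditions between a piece of [P.2] and a piece of [Q.2] hold automatically, so a cut
   of the shuffle is good exactly when both underlying cuts are. *)
have dE u v : u \in shuffle w.1 z.1 -> v \in shuffle w.2 z.2 ->
    disj u v = disj w.1 w.2 && disj z.1 z.2.
  move=> /shuffle_perm/perm_mem eu /shuffle_perm/perm_mem ev.
  rewrite (disj_mem eu ev) disj_catl !disj_catr.
  rewrite (disj_sub sw1 sz2 dPQ) (disjC z.1) (disj_sub sw2 sz1 dPQ).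
  by rewrite andbT.
case: ifP => d; last first.
  rewrite big1_seq // => u /= u1; rewrite big1_seq // => v /= v2.
  by rewrite /F (dE _ _ u1 v2) d.
have sP1 : {subset w.1 <= P.1} by move=> x /sw1; rewrite eP.
have sP2 : {subset w.2 <= P.1} by move=> x /sw2; rewrite eP.
have sQ1 : {subset z.1 <= Q.1} by move=> x /sz1; rewrite eQ.
have sQ2 : {subset z.2 <= Q.1} by move=> x /sz2; rewrite eQ.
rewrite (mul_basis_cls (part_subst sP1) (part_subst sQ1) (disj_sub sw1 sz1 dPQ)).
rewrite (mul_basis_cls (part_subst sP2) (part_subst sQ2) (disj_sub sw2 sz2 dPQ)).
rewrite [RHS]tensor_sumU; apply: eq_big_seq => u u1; apply: eq_big_seq => v v2.
rewrite /F (dE _ _ u1 v2) d /part.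
rewrite (restr_shuffle sP sQ dPQ sw1 sz1 u1).
by rewrite (restr_shuffle sP sQ dPQ sw2 sz2 v2).
Qed.

Lemma deg_eq0 p : (deg p == 0%N) = (p == empty_subst).
Proof.
rewrite -{2}(clsK p) cls_eq_empty ?subst_val // /deg size_eq0.
by apply/eqP/eqP => [/undup_nil|->].
Qed.

Lemma counitE a : counit a = a@_empty_subst.
Proof.
rewrite /counit [in RHS](monalgE a) raddf_sum /=; apply: eq_bigr => k _.
by rewrite mcoeffU /counit_basis mulr_natr.
Qed.

(** For the left counit law: the counit kills every cut except the one with empty left piece. *)
Lemma big_splits_first (V : zmodType) (F : seq nat * seq nat -> V) s :
  (forall x u v, F (x :: u, v) = 0) -> \sum_(w <- splits s) F w = F ([::], s).
Proof.
move=> F0; case: s => [|x s]; first by rewrite splits0 big_seq1.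
by rewrite big_splits_cons big1 ?addr0.
Qed.

Lemma big_splits_last (V : zmodType) (F : seq nat * seq nat -> V) s :
  (forall u x v, F (u, x :: v) = 0) -> \sum_(w <- splits s) F w = F (s, [::]).
Proof.
elim: s F => [|x s IH] F F0; first by rewrite splits0 big_seq1.
rewrite big_splits_cons F0 add0r.
by apply: (IH (fun w => F (x :: w.1, w.2))) => u y v; apply: F0.
Qed.

Lemma counit_basis_part rho u :
  {subset u <= rho} -> counit_basis (cls (part rho u)) = (u == [::])%:R.
Proof. by move=> s; rewrite /counit_basis cls_eq_empty //; apply: part_subst. Qed.

Lemma comul_basis_counitl p :
  lin (fun k => counit_basis k.1 *: << k.2 >>) (comul_basis p) = << p >>.
Proof.
have [P [sP <- _]] := disj_rep p [::]; have /is_subst_pairP eP := sP.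
rewrite (comul_basis_cls sP) [LHS]lin_sumU [LHS]big_mkcond.
transitivity (\sum_(w <- splits P.2)
  if disj w.1 w.2 then (w.1 == [::])%:R *: << cls (part P.1 w.2) >> else 0 : D).
  apply: eq_big_seq => w /splitsP ew.
  by rewrite counit_basis_part // => x xw; rewrite eP ew mem_cat xw.
rewrite big_splits_first /= => [|x u v]; first by rewrite scale1r part_id.
by rewrite scale0r if_same.
Qed.

Lemma comul_basis_counitr p :
  lin (fun k => counit_basis k.2 *: << k.1 >>) (comul_basis p) = << p >>.
Proof.
have [P [sP <- _]] := disj_rep p [::]; have /is_subst_pairP eP := sP.
rewrite (comul_basis_cls sP) [LHS]lin_sumU [LHS]big_mkcond.
transitivity (\sum_(w <- splits P.2)
  if disj w.1 w.2 then (w.2 == [::])%:R *: << cls (part P.1 w.1) >> else 0 : D).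
  apply: eq_big_seq => w /splitsP ew.
  by rewrite counit_basis_part // => x xw; rewrite eP ew mem_cat xw orbT.
rewrite big_splits_last /= => [|u x v]; last by rewrite scale0r if_same.
by rewrite disjC scale1r part_id.
Qed.

(** A shuffle of disjoint words has as support the disjoint union of their supports. *)
Lemma deg_mul_basis p q r : (mul_basis p q)@_r != 0 -> deg r = (deg p + deg q)%N.
Proof.
have [P [sP <- _]] := disj_rep p [::].
have [Q [sQ <- dPQ]] := disj_rep q P.2.
rewrite (mul_basis_cls sP sQ dPQ) => /mcoeff_sumU_neq0 [g [gPQ _ <-]].
rewrite !deg_cls ?(shuffle_subst sP sQ) //=.
rewrite (perm_size (perm_undup (perm_mem (shuffle_perm gPQ)))) undup_cat.
rewrite size_cat; congr (size _ + _)%N; apply/all_filterP/allP => x.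
by rewrite mem_undup => xP; apply: (allP dPQ).
Qed.

Lemma deg_comul_basis p k :
  (comul_basis p)@_k != 0 -> (deg k.1 + deg k.2)%N = deg p.
Proof.
have [P [sP <- _]] := disj_rep p [::]; have /is_subst_pairP eP := sP.
rewrite (comul_basis_cls sP) => /mcoeff_sumU_neq0 [w [/splitsP ew dw <-]] /=.
have [sw1 sw2] : {subset w.1 <= P.1} /\ {subset w.2 <= P.1}.
  by split=> x xw; rewrite eP ew mem_cat xw ?orbT.
rewrite !deg_cls ?part_subst //= ew undup_cat size_cat; congr (size _ + _)%N.
apply/esym/all_filterP/allP => x.
by rewrite mem_undup => xP; apply: (allP dw).
Qed.

Lemma counit_mul_basis p q :
  (mul_basis p q)@_empty_subst = counit_basis p * counit_basis q.
Proof.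
rewrite /counit_basis.
case: (altP (p =P empty_subst)) => [->|np].
  by rewrite mul_empty_basis mul1r mcoeffU.
(* If [p] is nonempty, its degree is positive, so no term of the product has degree zero. *)
rewrite mul0r; apply/eqP/negPn/negP => /deg_mul_basis/esym/eqP.
have /eqP -> : deg empty_subst == 0%N by rewrite deg_eq0.
by rewrite addn_eq0 !deg_eq0 (negbTE np).
Qed.

Lemma counitD_mul a b : counit (mulD a b) = counit a * counit b.
Proof.
rewrite counitE mulDE mcoeff_lin /counit mulr_suml; apply: eq_bigr => p _.
rewrite mcoeff_lin -mulrA; congr (_ * _); rewrite mulr_sumr.
by apply: eq_bigr => q _; rewrite counit_mul_basis mulrCA.
Qed.

End Bialgebra.

(** * The convolution algebra and the antipode *)

Section Antipode.
Implicit Types (p q : subst) (f g h : subst -> D).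

(** Convolution of linear endomorphisms, each represented by its values on the basis. *)
Definition conv f g p : D := lin (fun k => mulD (f k.1) (g k.2)) (comul_basis p).

Definition eta p : D := counit_basis p *: unitD.

(** Coassociativity lets both sides be read off the twofold coproduct; associativity of [mulD] then
    identifies the summands. *)
Lemma convA f g h : conv (conv f g) h =1 conv f (conv g h).
Proof.
move=> p.
pose F k := mulD (mulD (f k.1.1) (g k.1.2)) (h k.2).
transitivity (lin F (lin (fun k => lin (fun l => << (l, k.2) >>)
    (comul_basis k.1)) (comul_basis p))).
  rewrite [RHS]lin_lin; apply: eq_lin => k.
  rewrite [LHS]mulD_linl [RHS]lin_lin; apply: eq_lin => l.
  by rewrite [RHS]linU.
rewrite comul_basisA [LHS]lin_lin; apply: eq_lin => k.
rewrite [RHS]mulD_linr [LHS]lin_lin; apply: eq_lin => l.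
by rewrite [LHS]linU /F mulDA.
Qed.

Lemma conv_etal f : conv eta f =1 f.
Proof.
(* The left counit law is used backwards, inside the argument of [lin f]. *)
move=> p; rewrite -[RHS]linU -comul_basis_counitl [RHS]lin_lin.
by apply: eq_lin => k; rewrite linearZ /= linU [LHS]mulDZl mul1D.
Qed.

Lemma conv_etar f : conv f eta =1 f.
Proof.
move=> p; rewrite -[RHS]linU -comul_basis_counitr [RHS]lin_lin.
by apply: eq_lin => k; rewrite linearZ /= linU [LHS]mulDZr mulD1.
Qed.

Lemma eq_conv f f' g g' p :
  (forall k, (comul_basis p)@_k != 0 -> mulD (f k.1) (g k.2) = mulD (f' k.1) (g' k.2)) ->
  conv f g p = conv f' g' p.
Proof. exact: eq_lin_in. Qed.

Lemma conv_suml (I : Type) (r : seq I) (c : I -> int) (F : I -> subst -> D) g p :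
  conv (fun q => \sum_(i <- r) c i *: F i q) g p = \sum_(i <- r) c i *: conv (F i) g p.
Proof.
transitivity (lin (fun k => \sum_(i <- r) c i *: mulD (F i k.1) (g k.2))
    (comul_basis p)).
  by apply: eq_lin => k; apply: mulD_suml.
by rewrite [LHS]lin_sumf; apply: eq_bigr => i _; apply: linZf.
Qed.

Lemma conv_sumr (I : Type) (r : seq I) (c : I -> int) (F : I -> subst -> D) g p :
  conv g (fun q => \sum_(i <- r) c i *: F i q) p = \sum_(i <- r) c i *: conv g (F i) p.
Proof.
transitivity (lin (fun k => \sum_(i <- r) c i *: mulD (g k.1) (F i k.2))
    (comul_basis p)).
  by apply: eq_lin => k; apply: mulD_sumr.
by rewrite [LHS]lin_sumf; apply: eq_bigr => i _; apply: linZf.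
Qed.

Definition augm p : D := if p == empty_subst then 0 else << p >>.

Fixpoint augm_pow n : subst -> D :=
  if n is n'.+1 then conv (augm_pow n') augm else eta.

Lemma augm_powS n : augm_pow n.+1 = conv (augm_pow n) augm.
Proof. by []. Qed.

(** Powers are built by convolving with [augm] on the right; the right inverse property needs the
    factor on the left. *)
Lemma augm_powSr n : augm_pow n.+1 =1 conv augm (augm_pow n).
Proof.
elim: n => [|n IH] p.
  by rewrite [LHS]conv_etal [RHS]conv_etar.
rewrite augm_powS -convA; apply: eq_conv => k _.
by rewrite IH.
Qed.

(* A nonempty right factor of a cut has positive degree, so each factor of the
   convolution power lowers the degree by at least one. *)
Lemma augm_pow_eq0 n p : (deg p < n)%N -> augm_pow n p = 0.
Proof.
elim: n p => // n IH p lt.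
rewrite augm_powS -[RHS](lin0f (comul_basis p)).
apply: eq_lin_in => k /deg_comul_basis dk.
have [e|] := eqVneq k.2 empty_subst.
  by rewrite /augm e eqxx mulD0.
rewrite -deg_eq0 -lt0n => k2; rewrite IH; first by rewrite mul0D.
by rewrite -ltnS (leq_trans _ lt) // ltnS -dk -[X in (X < _)%N]addn0 ltn_add2l.
Qed.

Definition antipode p : D := \sum_(0 <= n < (deg p).+1) (-1) ^+ n *: augm_pow n p.

(** Any cutoff above the degree gives the same sum, so one [N] can serve all factors of a coproduct
    at once. *)
Lemma antipodeEw N p : (deg p < N)%N ->
  antipode p = \sum_(0 <= n < N) (-1) ^+ n *: augm_pow n p.
Proof.
move=> lt; rewrite [RHS](big_cat_nat (leq0n _) lt) /= [X in _ + X]big1_seq ?addr0 //.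
move=> n; rewrite mem_index_iota => /= /andP [ltn _].
by rewrite augm_pow_eq0 ?scaler0.
Qed.

Lemma eta_augm p : << p >> = eta p + augm p.
Proof.
rewrite /eta /augm /counit_basis; case: eqP => [->|_].
  by rewrite scale1r addr0.
by rewrite scale0r add0r.
Qed.

(** As the identity is [eta] plus [augm], this turns the convolution of a power of [augm] with the
    identity into a sum of two consecutive powers, ready to telescope. *)
Lemma conv_idr f p : conv f (fun q => << q >>) p = f p + conv f augm p.
Proof.
rewrite -[X in X + _](conv_etar f p) -[RHS]linDf; apply: eq_lin => k.
by rewrite eta_augm mulDDr.
Qed.

Lemma conv_idl f p : conv (fun q => << q >>) f p = f p + conv augm f p.
Proof.
rewrite -[X in X + _](conv_etal f p) -[RHS]linDf; apply: eq_lin => k.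
by rewrite eta_augm mulDDl.
Qed.

Lemma alternating_telescope (R : nzRingType) (V : lmodType R) (A : nat -> V) N :
  \sum_(0 <= n < N) (-1) ^+ n *: (A n + A n.+1) = A 0%N - (-1) ^+ N *: A N.
Proof.
elim: N => [|N IH]; first by rewrite big_geq // expr0 scale1r subrr.
rewrite big_nat_recr //= IH scalerDr addrA subrK exprS mulN1r scaleNr.
by rewrite opprK.
Qed.

Lemma antipode_convl p : conv antipode (fun q => << q >>) p = eta p.
Proof.
pose N := (deg p).+1.
rewrite (eq_conv (f' := fun q => \sum_(0 <= n < N) (-1) ^+ n *: augm_pow n q)
  (g' := fun q => << q >>)).
  (* The telescoped sum leaves the zeroth power, which is [eta], and the [N]-th power, which
     vanishes at [p] because [N] exceeds its degree. *)
  rewrite conv_suml; under eq_bigr do rewrite conv_idr.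
  by rewrite (alternating_telescope (augm_pow^~ p)) (augm_pow_eq0 (ltnSn _))
    scaler0 subr0.
(* A left factor of the coproduct of [p] has degree at most [deg p], so the common cutoff is
   admissible. *)
move=> k /deg_comul_basis dk; rewrite (antipodeEw (N := N)) //.
by rewrite ltnS -dk leq_addr.
Qed.

Lemma antipode_convr p : conv (fun q => << q >>) antipode p = eta p.
Proof.
pose N := (deg p).+1.
rewrite (eq_conv (f' := fun q => << q >>)
  (g' := fun q => \sum_(0 <= n < N) (-1) ^+ n *: augm_pow n q)).
  rewrite conv_sumr; under eq_bigr do rewrite conv_idl -augm_powSr.
  by rewrite (alternating_telescope (augm_pow^~ p)) (augm_pow_eq0 (ltnSn _))
    scaler0 subr0.
move=> k /deg_comul_basis dk; rewrite (antipodeEw (N := N)) //.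
by rewrite ltnS -dk leq_addl.
Qed.

End Antipode.

(** * Extension of the basis identities by linearity *)

Theorem theorem7p8 :
  (* m is associative with unit the empty substitution *)
  (forall a b c : D, mulD (mulD a b) c = mulD a (mulD b c)) /\
  (forall a : D, mulD unitD a = a /\ mulD a unitD = a) /\
  (* mu is coassociative with counit eps *)
  (forall a : D, tens comul idD (comul a) = reassoc (tens idD comul (comul a))) /\
  (forall a : D, counit_l (comul a) = a /\ counit_r (comul a) = a) /\
  (* all structure maps respect the grading *)
  (forall (p q : nat) (a b : D), homog p a -> homog q b -> homog (p + q) (mulD a b)) /\
  homog 0 unitD /\
  (forall (n : nat) (a : D), homog n a -> homog2 n (comul a)) /\
  (forall (n : nat) (a : D), homog n a -> n <> 0%N -> counit a = 0) /\
  (* connected: the degree 0 part is Z . 1 *)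
  (forall a : D, homog 0 a -> a = counit a *: unitD) /\
  (* mu and eps are algebra morphisms *)
  (forall x : FZ (subst * subst)%type,
      comul (m_lin x) = tens m_lin m_lin (mid_tw (tens comul comul x))) /\
  comul unitD = tensor unitD unitD /\
  (forall a b : D, counit (mulD a b) = counit a * counit b) /\
  counit unitD = 1 /\
  (* consequently dWHA is a Hopf algebra: there is an antipode *)
  (exists S : D -> D,
      (forall a b : D, S (a + b) = S a + S b) /\
      (forall a : D, m_lin (tens S idD (comul a)) = counit a *: unitD /\
                     m_lin (tens idD S (comul a)) = counit a *: unitD)).
Proof.
(* Puts the right side of the antipode identities in the form [lin], so that they can be checked on
   the basis. *)
have eta_lin a : counit a *: unitD = lin eta a.
  rewrite /counit scaler_suml; apply: eq_bigr => k _; exact/esym/scalerA.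
split; first exact: mulDA.
split; first by move=> a; rewrite mul1D mulD1.
split.
  move=> a; rewrite /comul [LHS]lin_lin [X in _ = reassoc X]lin_lin [RHS]lin_lin.
  apply: eq_lin => p.
  transitivity (lin (fun k => lin (fun l => << (l, k.2) >>) (comul_basis k.1))
      (comul_basis p)).
    apply: eq_lin => k; rewrite [LHS]tensorE [X in lin _ X = _]linU.
    by apply: eq_lin => l; rewrite linU.
  rewrite comul_basisA [RHS]lin_lin; apply: eq_lin => k.
  rewrite [RHS]lin_tensor [RHS]linU [X in _ = lin _ X]linU.
  by apply: eq_lin.
split.
  move=> a; split; rewrite /comul [LHS]lin_lin -[RHS]lin_id; apply: eq_lin => p.
    exact: comul_basis_counitl.
  exact: comul_basis_counitr.
split.
  move=> m n a b ha hb r; rewrite mulDE => /mcoeff_lin_neq0 [p /ha <-].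
  by move/mcoeff_lin_neq0 => [q /hb <-] /deg_mul_basis.
split.
  by move=> p; rewrite mcoeffU; case: (empty_subst =P p) => [<-|_ /eqP].
split.
  by move=> n a ha k /mcoeff_lin_neq0 [p /ha <-] /deg_comul_basis.
split.
  move=> n a ha n0; rewrite counitE; apply/eqP/negPn/negP => /ha e.
  by apply: n0; rewrite -e.
split.
  (* A basis element with nonzero coefficient in [a] has degree zero, hence is the empty
     substitution. *)
  move=> a ha; apply/malgP => p; rewrite mcoeffZ mcoeffU counitE.
  case: (empty_subst =P p) => [<-|np]; first by rewrite mulr1.
  rewrite mulr0; apply/eqP/negPn/negP => /ha/eqP.
  by rewrite deg_eq0 eq_sym => /eqP.
split.
  move=> x; rewrite [X in mid_tw X]/tens.
  rewrite [X in comul X]/m_lin [LHS]lin_lin [X in tens _ _ X]lin_lin [RHS]lin_lin.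
  apply: eq_lin => -[p q] /=; rewrite comul_mul_basis.
  rewrite [RHS]lin_lin [RHS]lin_tensor [X in _ = lin _ X]linU.
  apply: eq_lin => w; rewrite [X in _ = lin _ X]linU; apply: eq_lin => z.
  by rewrite [RHS]linU [X in _ = tensor X _]linU [X in _ = tensor _ X]linU.
split.
  rewrite /comul linU tensorU.
  (* The empty word has a single cut, both of whose pieces are empty. *)
  rewrite -{1}(clsK empty_subst) comul_basis_cls ?subst_val //.
  by rewrite splits0 big_mkcond big_seq1 /= -(clsK empty_subst).
split; first exact: counitD_mul.
split; first by rewrite counitE mcoeffU eqxx.
exists (lin antipode); split; first exact: linearD.
move=> a; rewrite eta_lin; split; rewrite /comul.
  rewrite [X in m_lin X]lin_lin [LHS]lin_lin; apply: eq_lin => p.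
  rewrite -antipode_convl [LHS]lin_lin; apply: eq_lin => k.
  by rewrite linU.
rewrite [X in m_lin X]lin_lin [LHS]lin_lin; apply: eq_lin => p.
rewrite -antipode_convr [LHS]lin_lin; apply: eq_lin => k.
by rewrite linU.
Qed.
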